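(* Let $\hat g\in C^1([-1,1])$ with $\hat g(-1)=-1$, $\hat g(1)=1$ and $\hat g'>0$ a.e. on $[-1,1]$, and let $g(y)=\hat g(-1+2y)$, $y\in[0,1]$. For every $N\ge1$ let $x_i=g(i/N)$, $i=0,\dots,N$, $h_i=x_i-x_{i-1}$, $i=1,\dots,N$, and let $\Delta_N\in\mathbb{R}^{N\times(N+1)}$ be the backward difference matrix given by $[\Delta_N\boldsymbol u]_i=\frac{u_i-u_{i-1}}{h_i}$, $i=1,\dots,N$, for $\boldsymbol u=[u_0,\dots,u_N]^\top\in\mathbb{R}^{N+1}$. Then $$\left\{\frac{\Delta_N}{N}\right\}_N\sim_{\mathrm{GLT}}\frac{1-e^{i\theta}}{g'(y)},\qquad (y,\theta)\in[0,1]\times[-\pi,\pi],$$ where, for this sequence of $N\times(N+1)$ matrices, the relation $\sim_{\mathrm{GLT}}$ is understood for the $N\times N$ matrices obtained from $\Delta_N/N$ by deleting its first (boundary) column, the one corresponding to $u_0$.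
   Context: GLT sequences (scalar, unilevel). All sequences $\{A_N\}_N$ below have $A_N\in\mathbb{C}^{N\times N}$; $\|\cdot\|$ is the spectral norm. (1) For $f\in L^1([-\pi,\pi])$, $T_N(f)=[\widehat f_{i-j}]_{i,j=1}^N$ with $\widehat f_k=\frac1{2\pi}\int_{-\pi}^{\pi}f(\theta)e^{-ik\theta}d\theta$. (2) For Riemann-integrable $a:[0,1]\to\mathbb{C}$, $D_N(a)=\operatorname{diag}(a(1/N),a(2/N),\dots,a(N/N))$. (3) $\{Z_N\}_N$ is zero-distributed ($\{Z_N\}_N\sim_\sigma0$) if for every $\varepsilon>0$ the number of singular values of $Z_N$ larger than $\varepsilon$, divided by $N$, tends to $0$ as $N\to\infty$. (4) $\{B_{N,m}\}_N\xrightarrow{\mathrm{a.c.s.}}\{A_N\}_N$ as $m\to\infty$ means: for every $m$ and all sufficiently large $N$ one can write $A_N=B_{N,m}+R_{N,m}+E_{N,m}$ with $\operatorname{rank}(R_{N,m})\le c_mN$, $\|E_{N,m}\|\le s_m$, where $c_m\to0$ and $s_m\to0$ as $m\to\infty$. The relation $\{A_N\}_N\sim_{\mathrm{GLT}}\kappa$, with $\kappa:[0,1]\times[-\pi,\pi]\to\mathbb{C}$ measurable and identified up to a.e. equality, is the smallest relation such that: $\{T_N(f)\}_N\sim_{\mathrm{GLT}}f(\theta)$ for $f\in L^1([-\pi,\pi])$; $\{D_N(a)\}_N\sim_{\mathrm{GLT}}a(y)$ for Riemann-integrable $a$; $\{Z_N\}_N\sim_{\mathrm{GLT}}0$ for zero-distributed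 $\{Z_N\}_N$; if $\{A_N\}_N\sim_{\mathrm{GLT}}\kappa$ and $\{B_N\}_N\sim_{\mathrm{GLT}}\varsigma$ then $\{A_N^*\}_N\sim_{\mathrm{GLT}}\overline\kappa$, $\{\lambda A_N+\mu B_N\}_N\sim_{\mathrm{GLT}}\lambda\kappa+\mu\varsigma$ ($\lambda,\mu\in\mathbb{C}$), $\{A_NB_N\}_N\sim_{\mathrm{GLT}}\kappa\varsigma$, and $\{A_N^\dagger\}_N\sim_{\mathrm{GLT}}\kappa^{-1}$ (Moore–Penrose pseudo-inverse) if $\kappa\ne0$ a.e.; if $\{B_{N,m}\}_N\sim_{\mathrm{GLT}}\kappa_m$ for every $m$, $\{B_{N,m}\}_N\xrightarrow{\mathrm{a.c.s.}}\{A_N\}_N$ and $\kappa_m\to\kappa$ in measure, then $\{A_N\}_N\sim_{\mathrm{GLT}}\kappa$. *)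

(* Defs.v *)
From mathcomp Require Import all_boot all_order all_algebra.
From mathcomp Require Import spectral.
From mathcomp Require Import all_classical all_reals all_analysis.
From mathcomp Require Import complex.

Set Implicit Arguments.
Unset Strict Implicit.
Unset Printing Implicit Defensive.
Import Order.TTheory GRing.Theory Num.Theory numFieldNormedType.Exports.
Local Open Scope classical_set_scope.
Local Open Scope ring_scope.
Local Open Scope sesquilinear_scope.

Section Calculus.
Context {R : realType}.
Implicit Types (D : set R) (f : R -> R) (a b x : R).

(* Derivatives relative to a set: one-sided at the endpoints of an interval;
   the values of f outside D are irrelevant. *)
Definition diff_quot f x : R -> R := fun y => (f y - f x) / (y - x).

Definition derivable_in D f x : Prop := cvg (diff_quot f x @ within D x^').

Definition derive_in D f x : R := lim (diff_quot f x @ within D x^').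

Definition C1_on D f : Prop :=
  (forall x, D x -> derivable_in D f x) /\ {within D, continuous (derive_in D f)}.

(* [a :: s] lists the nodes of a partition of [a, b] (see itv_partition) and
   xi lists the tags. *)
Definition tagged a (s : seq R) (xi : nat -> R) : Prop :=
  forall i, (i < size s)%N -> nth 0 (a :: s) i <= xi i <= nth 0 s i.

Definition mesh_lt a (s : seq R) (d : R) : Prop :=
  forall i, (i < size s)%N -> nth 0 s i - nth 0 (a :: s) i < d.

Definition riemann_sum f a (s : seq R) (xi : nat -> R) : R :=
  \sum_(i < size s) f (xi i) * (nth 0 s i - nth 0 (a :: s) i).

Definition riemann_integrable a b f : Prop :=
  exists I : R, forall e, 0 < e -> exists2 d, 0 < d &
    forall s xi, itv_partition a b s -> tagged a s xi -> mesh_lt a s d ->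
      `|riemann_sum f a s xi - I| < e.

End Calculus.

Section ComplexValued.
Context {R : realType}.

Definition expi (t : R) : R[i] := (cos t +i* sin t)%C.

Definition cmeasurable_fun d (T : measurableType d) (D : set T) (f : T -> R[i]) :=
  measurable_fun D (fun x => complex.Re (f x)) /\
  measurable_fun D (fun x => complex.Im (f x)).

Definition cintegrable (D : set R) (f : R -> R[i]) : Prop :=
  (@lebesgue_measure R).-integrable D (fun x => (complex.Re (f x))%:E) /\
  (@lebesgue_measure R).-integrable D (fun x => (complex.Im (f x))%:E).

Definition cintegral (D : set R) (f : R -> R[i]) : R[i] :=
  (Rintegral (@lebesgue_measure R) D (fun x => complex.Re (f x)) +i*
   Rintegral (@lebesgue_measure R) D (fun x => complex.Im (f x)))%C.

Definition criemann_integrable (a b : R) (f : R -> R[i]) : Prop :=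
  riemann_integrable a b (fun x => complex.Re (f x)) /\
  riemann_integrable a b (fun x => complex.Im (f x)).

Definition cvg_in_measure d (T : measurableType d)
    (mu : {measure set T -> \bar R}) (D : set T)
    (f_ : nat -> T -> R[i]) (f : T -> R[i]) : Prop :=
  forall e : R, 0 < e ->
    mu (D `&` [set x | e < ComplexField.Normc.normc (f_ m x - f x)]) @[m --> \oo] --> 0%E.

End ComplexValued.

Section Matrices.
Context {R : realType}.

(* The spectrum of A^* A consists of nonnegative reals; spectral_diag lists it
   with multiplicities, so taking real parts loses nothing. *)
Definition sing_val n (A : 'M[R[i]]_n) (i : 'I_n) : R :=
  Num.sqrt (complex.Re (spectral_diag (A ^t* *m A) 0 i)).

Definition spectral_norm n (A : 'M[R[i]]_n) : R :=
  \big[Num.max/0]_(i < n) sing_val A i.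

Definition is_moore_penrose n (A X : 'M[R[i]]_n) : Prop :=
  [/\ A *m X *m A = A, X *m A *m X = X,
      (A *m X) ^t* = A *m X & (X *m A) ^t* = X *m A].

Definition bdiff_mx (x : nat -> R) N : 'M[R]_(N, N.+1) :=
  \matrix_(i < N, j < N.+1)
    (((j == i.+1 :> nat)%:R - (j == i :> nat)%:R) / (x i.+1 - x i)).

Lemma bdiff_mxE (x u : nat -> R) N (i : 'I_N) :
  (bdiff_mx x N *m \col_(j < N.+1) u j) i 0 =
    (u i.+1 - u i) / (x i.+1 - x i).
Proof.
rewrite mxE; under eq_bigr => j _ do rewrite !mxE mulrAC.
rewrite -mulr_suml; congr (_ / _).
under eq_bigr => j _ do rewrite mulrBl.
rewrite sumrB; congr (_ - _).
- rewrite (bigD1 (lift ord0 i)) //= big1 ?addr0 ?eqxx ?mul1r // => j.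
  by rewrite -val_eqE /= => /negbTE ->; rewrite mul0r.
- rewrite (bigD1 (widen_ord (leqnSn N) i)) //= big1 ?addr0 ?eqxx ?mul1r // => j.
  by rewrite -val_eqE /= => /negbTE ->; rewrite mul0r.
Qed.

End Matrices.

Section GLT.
Context {R : realType}.

(* The index N = 0 carries no information: 'M_0 is a singleton. *)
Definition mxseq : Type := forall N : nat, 'M[R[i]]_N.

Definition fourier_coef (f : R -> R[i]) (k : int) : R[i] :=
  ((2 * pi)^-1)%:C%C *
  cintegral `[- pi, pi] (fun t => f t * expi (- (k%:~R * t))).

Definition toeplitz (f : R -> R[i]) : mxseq := fun N =>
  \matrix_(i < N, j < N) fourier_coef f ((i : nat)%:Z - (j : nat)%:Z).

Definition diag_sampling (a : R -> R[i]) : mxseq := fun N =>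
  diag_mx (\row_(i < N) a (i.+1%:R / N%:R)).

Definition zero_distributed (Z : mxseq) : Prop :=
  forall e : R, 0 < e ->
    (#|[set i : 'I_N | e < sing_val (Z N) i]%SET|%:R / N%:R : R)
      @[N --> \oo] --> 0.

Definition acs (B : nat -> mxseq) (A : mxseq) : Prop :=
  exists c s : nat -> R,
    [/\ c m @[m --> \oo] --> 0, s m @[m --> \oo] --> 0 &
        forall m, \forall N \near \oo, exists E1 E2 : 'M[R[i]]_N,
          [/\ A N = B m N + E1 + E2,
              (\rank E1)%:R <= c m * N%:R &
              spectral_norm E2 <= s m]].

Definition glt_dom : set (R * R) := `[0, 1] `*` `[- pi, pi].

Definition mu2 : {measure set (measurableTypeR R * measurableTypeR R) -> \bar R} :=
  (@lebesgue_measure R \x @lebesgue_measure R)%E.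

(* Symbols are functions on R * R of which only the values on glt_dom matter,
   up to null sets (glt_ae).  The measurable sets of R and R * R are the Borel
   ones; a Lebesgue measurable symbol is a.e. equal to a Borel one, so by glt_ae
   it is harmless that glt_toeplitz and glt_acs are restricted to Borel
   representatives. *)
Inductive glt : mxseq -> (R * R -> R[i]) -> Prop :=
| glt_toeplitz f :
    cintegrable `[- pi, pi] f -> glt (toeplitz f) (fun p => f p.2)
| glt_diag a :
    criemann_integrable 0 1 a -> glt (diag_sampling a) (fun p => a p.1)
| glt_zero Z : zero_distributed Z -> glt Z (fun=> 0)
| glt_adjoint A k : glt A k -> glt (fun N => A N ^t*) (fun p => Num.conj (k p))
| glt_lin (l m : R[i]) A B k k' : glt A k -> glt B k' ->
    glt (fun N => l *: A N + m *: B N) (fun p => l * k p + m * k' p)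
| glt_mul A B k k' : glt A k -> glt B k' ->
    glt (fun N => A N *m B N) (fun p => k p * k' p)
| glt_pinv A X k : glt A k ->
    {ae mu2, forall p, glt_dom p -> k p != 0} ->
    (forall N, is_moore_penrose (A N) (X N)) ->
    glt X (fun p => (k p)^-1)
| glt_acs B A k_ k : (forall m, glt (B m) (k_ m)) ->
    acs B A ->
    (forall m, cmeasurable_fun glt_dom (k_ m)) -> cmeasurable_fun glt_dom k ->
    cvg_in_measure mu2 glt_dom k_ k ->
    glt A k
| glt_ae A k k' : glt A k ->
    {ae mu2, forall p, glt_dom p -> k p = k' p} ->
    glt A k'.

End GLT.

(* Main.v *)
Require Import Defs.
From mathcomp Require Import all_boot all_order all_algebra.
From mathcomp Require Import spectral.
From mathcomp Require Import all_classical all_reals all_analysis.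
From mathcomp Require Import measurable_realfun complex.
From mathcomp Require Import ring lra.

Set Implicit Arguments.
Unset Strict Implicit.
Unset Printing Implicit Defensive.
Import Order.TTheory GRing.Theory Num.Theory numFieldNormedType.Exports.
Local Open Scope classical_set_scope.
Local Open Scope ring_scope.

(** Deleting the first column of the scaled backward difference matrix leaves
    a lower bidiagonal matrix that factors exactly as [diag(d_i)^-1 T], where
    [d_i = N (g(i/N) - g((i-1)/N))] is the mean slope of [g] over the [i]-th
    cell of the uniform grid and [T] is the Toeplitz matrix generated by
    [1 - e^(i t)], whose only nonzero Fourier coefficients are [1] at [0] and
    [-1] at [1] ([bdiff_mx_factor], [fourier_bdiff_symbol]).  The statement
    therefore reduces to the symbol of [diag(d_i)].

    By the mean value theorem [d_i] is a value of [g'] at a point at distance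
    at most [1/N] from [i/N], and [g'] is uniformly continuous, so
    [diag(d_i) - D_N(g')] is a diagonal matrix whose entries tend uniformly to
    [0].  The singular values of a real diagonal matrix are absolute values of
    its entries ([sing_val_rdiag]), hence this difference is zero-distributed
    and [diag(d_i)] has symbol [g'(y)] ([glt_mean_slope]).

    The Moore-Penrose inverse of a diagonal matrix inverts its nonzero entries
    and keeps the zeros, which is entrywise inversion with the convention
    [0^-1 = 0]; so the inversion rule applies without having to show that the
    mean slopes are nonzero.  It does require [g' != 0] almost everywhere on
    [[0, 1] * [-pi, pi]].  This comes from the assumption on [ghat']: an affine
    change of variable preserves null sets ([negligible_affine]), and a null
    set of values of [y] gives a null strip in the plane
    ([ae_glt_dom_fst]). *)

(** * Differential calculus relative to a segment *)

Section Calculus.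
Context {R : realType}.
Implicit Types (f h : R -> R) (D : set R) (a b x y l e : R).

Lemma cvg_diff_quotP D f x l :
  diff_quot f x y @[y --> within D x^'] --> l <->
  forall e, 0 < e -> exists2 d : R, 0 < d & forall y, D y -> y != x ->
    `|y - x| < d -> `|diff_quot f x y - l| < e.
Proof.
split=> [/cvgrPdist_lt fl e e0 | fl].
  have [d /= d0 dl] := fl e e0.
  by exists d => // y Dy yx xy; rewrite distrC; apply: dl => //; rewrite /= distrC.
apply/cvgrPdist_lt => e e0; have [d d0 dl] := fl e e0.
exists d => //= y xy yx Dy; rewrite distrC; apply: dl => //.
by rewrite distrC.
Qed.

Lemma within_continuousP D f :
  {within D, continuous f} <->
  forall x, D x -> forall e, 0 < e -> exists2 d : R, 0 < d & forall y, D y ->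
    `|y - x| < d -> `|f y - f x| < e.
Proof.
rewrite subspace_continuousP; split=> fc x Dx.
  move=> e e0; have /cvgrPdist_lt /(_ e e0) [d /= d0 dl] := fc x Dx.
  by exists d => // y Dy xy; rewrite distrC; apply: dl => //; rewrite /= distrC.
apply/cvgrPdist_lt => e e0; have [d d0 dl] := fc x Dx e e0.
exists d => //= y xy Dy; rewrite distrC; apply: dl => //.
by rewrite distrC.
Qed.

(** The limit defining a relative derivative at a point of a nondegenerate
    segment is unique, endpoints included: from a point in the left half of the
    segment one can move to the right, from the right half to the left. *)
Lemma within_dnbhs_proper a b x : a < b -> a <= x <= b ->
  ProperFilter (within `[a, b] x^').
Proof.
move=> ab /andP[ax xb]; apply: Build_ProperFilter_ex => P [d /= d0 dP].
pose m := Num.min (d / 2) ((b - a) / 2).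
have m0 : 0 < m by rewrite lt_min; apply/andP; split; lra.
have [md mab] : m <= d / 2 /\ m <= (b - a) / 2.
  by split; rewrite ge_min lexx ?orbT.
have [xm|xm] := leP x ((a + b) / 2).
- exists (x + m); apply: dP => /=.
  + by rewrite opprD addrA subrr sub0r normrN gtr0_norm; lra.
  + by rewrite gt_eqF// ltrDl.
  + by rewrite in_itv/=; lra.
- exists (x - m); apply: dP => /=.
  + by rewrite opprB addrC subrK gtr0_norm; lra.
  + by rewrite lt_eqF// ltrBlDr ltrDl.
  + by rewrite in_itv/=; lra.
Qed.

Lemma derive_in_cvg D f x :
  derivable_in D f x -> diff_quot f x y @[y --> within D x^'] --> derive_in D f x.
Proof. by []. Qed.

Lemma derive_inE a b f x l : a < b -> a <= x <= b ->
  diff_quot f x y @[y --> within `[a, b] x^'] --> l ->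
  derivable_in `[a, b] f x /\ derive_in `[a, b] f x = l.
Proof.
move=> ab axb fl; have PF := within_dnbhs_proper ab axb.
split; first by apply/cvg_ex; exists l.
exact: (cvg_lim _ fl).
Qed.

Lemma derivable_in_continuous D f :
  (forall x, D x -> derivable_in D f x) -> {within D, continuous f}.
Proof.
move=> fD; apply/within_continuousP => x Dx e e0.
have /cvg_diff_quotP/(_ 1 ltr01)[d d0 dl] := derive_in_cvg (fD x Dx).
set l := derive_in D f x in dl.
have L0 : 0 < `|l| + 1 by rewrite ltr_wpDl.
exists (Num.min d (e / (`|l| + 1))); first by rewrite lt_min d0 divr_gt0.
move=> y Dy; rewrite lt_min => /andP[xyd xye].
have [->|yx] := eqVneq y x; first by rewrite subrr normr0.
have yx0 : y - x != 0 by rewrite subr_eq0.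
have -> : f y - f x = diff_quot f x y * (y - x) by rewrite /diff_quot mulfVK.
rewrite normrM -ltr_pdivlMr ?normr_gt0//.
have ql : `|diff_quot f x y| < `|l| + 1.
  by have := ler_normB (diff_quot f x y - l) (- l); rewrite opprK subrK normrN;
    have := dl y Dy yx xyd; lra.
apply: (lt_trans ql).
by rewrite ltr_pdivlMr ?normr_gt0// mulrC -ltr_pdivlMr.
Qed.

(** At an interior point the segment contains a full neighbourhood, so the
    relative derivative is the ordinary one and the usual mean value theorem
    applies. *)
Lemma C1_on_MVT a b f x y : C1_on `[a, b] f -> a <= x -> x < y -> y <= b ->
  exists2 c, x <= c <= y & f y - f x = derive_in `[a, b] f c * (y - x).
Proof.
move=> [fD _] ax xy yb.
have sub : `[x, y] `<=` `[a, b].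
  by move=> z /=; rewrite !in_itv/= => /andP[? ?]; lra.
suff [c] : exists2 c, c \in `[x, y] & f y - f x = derive_in `[a, b] f c * (y - x).
  by rewrite in_itv/=; exists c.
apply: MVT_segment (ltW xy) _ _ => [z|].
- rewrite in_itv/= => /andP[xz zy].
  have /derive_in_cvg/cvg_diff_quotP fz : derivable_in `[a, b] f z.
    by apply: fD; rewrite /= in_itv/=; lra.
  have dq : h^-1 *: (f (h *: 1 + z) - f z) @[h --> 0^'] --> derive_in `[a, b] f z.
    apply/cvgrPdist_lt => e e0; have [d d0 dl] := fz e e0.
    pose m := Num.min d (Num.min (z - x) (y - z)).
    exists m => /=; first by rewrite !lt_min d0; lra.
    move=> t /=; rewrite sub0r normrN; rewrite !lt_min => /andP[td].
    move=> /andP[/ltr_normlP[? ?] /ltr_normlP[? ?]] t0.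
    have tzab : `[a, b]%classic (t + z) by rewrite /= in_itv/=; apply/andP; split; lra.
    have tzz : t + z != z by rewrite -subr_eq0 addrK.
    have := dl (t + z) tzab tzz; rewrite /diff_quot addrK => /(_ td).
    have -> : t *: 1 + z = t + z by congr (_ + z); exact: mulr1.
    by rewrite distrC mulrC.
  apply: DeriveDef; first by apply/cvg_ex; exists (derive_in `[a, b] f z).
  exact: cvg_lim dq.
- exact: continuous_subspaceW sub (derivable_in_continuous fD).
Qed.

(** Heine-Cantor theorem, obtained from the covering form of compactness: the
    modulus [d] plays the role of the parameter that can be chosen uniformly
    once it can be chosen locally. *)
Lemma compact_unif_continuous D f e : compact D -> {within D, continuous f} -> 0 < e ->
  exists2 d : R, 0 < d & forall x y, D x -> D y -> `|y - x| < d -> `|f y - f x| < e.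
Proof.
move=> cD /within_continuousP fc e0.
have/compact_near_coveringP := cD.
move=> /(_ _ (0 : R)^'+ (fun d x => forall y, D x -> D y -> `|y - x| < d -> `|f y - f x| < e)).
case=> [x Dx|d /= d0 dP].
  have e20 : 0 < e / 2 by rewrite divr_gt0.
  have [d d0 dP] := fc x Dx (e / 2) e20.
  have d20 : 0 < d / 2 by rewrite divr_gt0.
  exists (ball x (d / 2), [set r | r < d / 2]).
    split; first exact: nbhsx_ballx.
    by exists (d / 2) => //= r /ltr_normlP[? ?] _; lra.
  move=> [z r] [/= xz rd] y Dz Dy yz.
  rewrite /ball/= distrC in xz.
  have zx : `|f z - f x| < e / 2 by apply: dP => //; lra.
  have yx : `|f y - f x| < e / 2.
    by apply: dP => //; have := ler_distD z y x; lra.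
  by have := ler_distD (f x) (f y) (f z); rewrite (distrC (f x)); lra.
exists (d / 2); first by rewrite divr_gt0.
move=> x y Dx Dy; apply: dP => //=; last by rewrite divr_gt0.
by rewrite sub0r normrN gtr0_norm ?divr_gt0// ltr_pdivrMr// ltr_pMr// ltr1n.
Qed.

Lemma C1_on_affine a b c s f h : a < b -> 0 < s ->
  (forall y, a <= y <= b -> f y = h (c + s * y)) ->
  C1_on `[c + s * a, c + s * b] h ->
  C1_on `[a, b] f /\
  (forall y, a <= y <= b ->
    derive_in `[a, b] f y = s * derive_in `[c + s * a, c + s * b] h (c + s * y)).
Proof.
move=> ab s0 fE [hD hC].
have phi y : a <= y <= b -> `[c + s * a, c + s * b]%classic (c + s * y).
  by move=> ayb; rewrite /= in_itv/= !lerD2l !ler_pM2l.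
have key y : a <= y <= b -> derivable_in `[a, b] f y /\
    derive_in `[a, b] f y = s * derive_in `[c + s * a, c + s * b] h (c + s * y).
  move=> ayb; apply: derive_inE => //; apply/cvg_diff_quotP => e e0.
  have /derive_in_cvg/cvg_diff_quotP := hD _ (phi y ayb).
  move=> /(_ (e / s) (divr_gt0 e0 s0))[d d0 dP].
  exists (d / s); first exact: divr_gt0.
  move=> z /=; rewrite in_itv/= => azb zy.
  rewrite ltr_pdivlMr// => zyd.
  have sd : c + s * z - (c + s * y) = s * (z - y) by ring.
  have yz0 : z - y != 0 by rewrite subr_eq0.
  have zd : `|c + s * z - (c + s * y)| < d.
    by rewrite sd normrM gtr0_norm// mulrC.
  have zyn : c + s * z != c + s * y.
    by rewrite -subr_eq0 sd mulf_neq0// gt_eqF.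
  have -> : diff_quot f y z - s * derive_in `[c + s * a, c + s * b] h (c + s * y) =
      s * (diff_quot h (c + s * y) (c + s * z) -
           derive_in `[c + s * a, c + s * b] h (c + s * y)).
    rewrite mulrBr; congr (_ - _); rewrite /diff_quot !fE// sd; field.
    by rewrite yz0 gt_eqF.
  rewrite normrM gtr0_norm// mulrC -ltr_pdivlMr//.
  exact: dP (phi z azb) zyn zd.
split=> [|y /key[]//]; split=> [y|].
  by rewrite /= in_itv/= => /key[].
apply/within_continuousP => y /=; rewrite in_itv/= => ayb e e0.
have /within_continuousP/(_ _ (phi y ayb) (e / s) (divr_gt0 e0 s0))[d d0 dP] := hC.
exists (d / s); first exact: divr_gt0.
move=> z; rewrite in_itv/= => azb; rewrite ltr_pdivlMr// => zyd.
rewrite (key y ayb).2 (key z azb).2 -mulrBr normrM gtr0_norm//.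
rewrite mulrC -ltr_pdivlMr//; apply: dP; first exact: phi.
have -> : c + s * z - (c + s * y) = s * (z - y) by ring.
by rewrite normrM gtr0_norm// mulrC.
Qed.

(** For a derivative, Riemann integrability needs no upper and lower sums: on
    each cell the increment of [f] is a value of [f'] times the length, so
    every Riemann sum differs from the telescoping sum [f b - f a] by at most
    the oscillation of [f'] at the scale of the mesh. *)
Lemma C1_on_riemann_integrable a b f : C1_on `[a, b] f ->
  riemann_integrable a b (derive_in `[a, b] f).
Proof.
move=> fC1; exists (f b - f a) => e e0.
have [ba|ab] := ltP b a.
  exists 1 => // s xi /itv_partition_le; rewrite leNgt => /negP; case; exact: ba.
(* The added 1 keeps the denominator positive when a = b. *)
have e10 : 0 < e / (b - a + 1) by rewrite divr_gt0//; lra.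
have [d d0 dP] := compact_unif_continuous (@segment_compact R a b) fC1.2 e10.
exists d => // s xi [pth /eqP lst] tg ms.
have mono i j : (i <= j)%N -> (j <= size s)%N ->
    nth 0 (a :: s) i <= nth 0 (a :: s) j.
  move=> ij js; have : sorted <=%R (a :: s).
    exact: sub_path (@ltW _ _) _ _ pth.
  move=> /(sorted_leq_nth le_trans lexx 0) -> //; by rewrite inE/= ltnS// (leq_trans ij).
have mem i : (i <= size s)%N -> a <= nth 0 (a :: s) i <= b.
  move=> le_is; rewrite -lst (last_nth 0) (mono 0%N)// mono//.
have tel (F : R -> R) : F b - F a =
    \sum_(i < size s) (F (nth 0 s i) - F (nth 0 (a :: s) i)).
  rewrite -(big_mkord xpredT (fun i => F (nth 0 (a :: s) i.+1) - F (nth 0 (a :: s) i))).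
  by rewrite telescope_sumr// -lst (last_nth 0).
rewrite tel /riemann_sum -sumrB.
have -> : e = (e / (b - a + 1)) * (b - a + 1) by rewrite divfK//; lra.
apply: (@le_lt_trans _ _ ((e / (b - a + 1)) * (b - a))); last by rewrite ltr_pM2l//; lra.
rewrite [X in _ <= _ * X](tel id) mulr_sumr; apply: le_trans (ler_norm_sum _ _ _) _.
apply: ler_sum => i _.
have i_lt := ltn_ord i.
have lti : nth 0 (a :: s) i < nth 0 s i by have /(pathP 0)/(_ i i_lt) := pth.
have /andP[ai _] := mem i (ltnW i_lt).
have /andP[_ bi] : a <= nth 0 s i <= b by exact: (mem i.+1).
have [c /andP[ic ci] ->] := C1_on_MVT fC1 ai lti bi.
have /andP[ix xi'] := tg i i_lt.
rewrite /= -mulrBl normrM [X in _ * X]gtr0_norm ?subr_gt0//.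
apply: ler_wpM2r; first by rewrite subr_ge0 ltW.
apply/ltW/dP; rewrite /= ?in_itv/=; [lra|lra|].
by have := ms i i_lt; rewrite ltr_norml; lra.
Qed.

Lemma riemann_integrable_cst a b (c : R) : riemann_integrable a b (fun=> c).
Proof.
exists (c * (b - a)) => e e0; exists 1 => // s xi [_ /eqP lst] _ _.
rewrite /riemann_sum -mulr_sumr.
rewrite -(big_mkord xpredT (fun i => nth 0 (a :: s) i.+1 - nth 0 (a :: s) i)).
by rewrite telescope_sumr// -lst (last_nth 0) subrr normr0.
Qed.

End Calculus.

(** * Real diagonal matrices *)

Section DiagonalMatrices.
Context {R : realType}.
Local Open Scope sesquilinear_scope.

Definition rdiag n (d : 'I_n -> R) : 'M[R[i]]_n := diag_mx (\row_i (d i)%:C%C).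

Lemma rdiag_adj n (d : 'I_n -> R) : (rdiag d) ^t* = rdiag d.
Proof.
rewrite /rdiag; apply/matrixP => i j; rewrite !mxE eq_sym.
have [->|_] := eqVneq j i; first by rewrite !mulr1n; exact: conjc_real.
by rewrite !mulr0n; exact: conjc0.
Qed.

Lemma rdiagM n (d d' : 'I_n -> R) :
  rdiag d *m rdiag d' = rdiag (fun i => d i * d' i).
Proof.
rewrite /rdiag mulmx_diag; congr diag_mx.
by apply/rowP => i; rewrite !mxE rmorphM.
Qed.

(** Entrywise inversion is the pseudo-inverse because [x * x^-1 * x = x] also
    holds for [x = 0], where [0^-1 = 0]. *)
Lemma rdiag_moore_penrose n (d : 'I_n -> R) :
  is_moore_penrose (rdiag d) (rdiag (fun i => (d i)^-1)).
Proof.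
have cancel (x : R) : x * x^-1 * x = x.
  by have [->|x0] := eqVneq x 0; rewrite ?mul0r// divfK.
split; rewrite !rdiagM ?rdiag_adj//; congr rdiag; apply/funext => i.
  exact: cancel.
by rewrite -[X in _ * X * _]invrK cancel.
Qed.

(** Comparing the entries of [P A = diag(sp) P] gives
    [P i j * d j = sp i * P i j]; an invertible [P] has a nonzero entry in its
    [i]-th row, and that entry can be cancelled. *)
Lemma spectral_diag_rdiag n (d : 'I_n -> R) i :
  exists j, spectral_diag (rdiag d) 0 i = (d j)%:C%C.
Proof.
set A := rdiag d; set P := spectralmx A; set sp := spectral_diag A.
have An : A \is normalmx by apply/normalmxP; rewrite rdiag_adj.
have PA : P *m A = diag_mx sp *m P.
  rewrite [X in _ *m X](orthomx_spectralP An) -/P -/sp !mulmxA.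
  by rewrite mulmxV ?spectral_unit// mul1mx.
have [j Pij] : exists j, P i j != 0.
  apply/existsP; rewrite -negb_forall; apply/negP => /forallP P0.
  have : row i P = 0 by apply/rowP => j; rewrite !mxE; exact/eqP.
  move/(congr1 (mulmx^~ (invmx P))); rewrite -row_mul mulmxV ?spectral_unit//.
  rewrite mul0mx => /rowP/(_ i); rewrite !mxE eqxx => /eqP.
  by rewrite oner_eq0.
exists j; move: PA => /matrixP/(_ i j).
by rewrite mul_mx_diag mul_diag_mx !mxE mulrC => /(mulIf Pij).
Qed.

Lemma sing_val_rdiag n (d : 'I_n -> R) i : exists j, sing_val (rdiag d) i = `|d j|.
Proof.
rewrite /sing_val rdiag_adj rdiagM.
have [j ->] := spectral_diag_rdiag (fun i => d i * d i) i.
by exists j; rewrite /= -expr2 sqrtr_sqr.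
Qed.

(** Once all entries are at most [e] in absolute value, no singular value
    exceeds [e], so the proportion in question is eventually equal to [0]. *)
Lemma rdiag_zero_distributed (d : forall N, 'I_N -> R) :
  (forall e : R, 0 < e -> \forall N \near \oo, forall i, `|d N i| <= e) ->
  zero_distributed (fun N => rdiag (d N)).
Proof.
move=> d0 e e0; apply: cvg_near_cst.
apply: filterS (d0 e e0) => N dN; apply/eqP.
rewrite eq_card0 ?mul0r// => i.
rewrite inE; have [j ->] := sing_val_rdiag (d N) i.
by apply/negbTE; rewrite -leNgt.
Qed.

End DiagonalMatrices.

(** * Fourier coefficients of the symbol of the backward difference *)

Section Fourier.
Context {R : realType}.
Notation mu := (@lebesgue_measure R).
Implicit Types (a b : R) (f F : R -> R) (k : int).

Lemma integrable_continuous_itv a b f : continuous f ->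
  mu.-integrable `[a, b] (EFin \o f).
Proof.
move=> fc; apply: continuous_compact_integrable; first exact: segment_compact.
exact: continuous_subspaceT.
Qed.

Lemma Rintegral_is_derive a b f F : a < b -> continuous f ->
  (forall x : R, is_derive x 1 F (f x)) -> Rintegral mu `[a, b] f = F b - F a.
Proof.
move=> ab fc dF.
have dF' (x : R) : derivable F x 1 by exact: ex_derive.
have Fc : continuous F by move=> x; apply/differentiable_continuous/derivable1_diffP.
rewrite /Rintegral (@continuous_FTC2 _ f F)//.
- exact: continuous_subspaceT.
- by split=> //; [exact/cvg_at_right_filter/Fc | exact/cvg_at_left_filter/Fc].
- by move=> x _; rewrite derive1E derive_val.
Qed.

Lemma sin_intpi k : sin (k%:~R * pi) = 0 :> R.
Proof.
have nat n : sin (n%:R * pi) = 0 :> R.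
  by have := alternatingn (@sinDpi R) n 0; rewrite add0r sin0 mulr0 mulr_natl.
case: k => n; first exact: nat.
by rewrite NegzE mulrNz mulNr sinN nat oppr0.
Qed.

Lemma continuous_cosM (c : R) : continuous (fun t : R => cos (c * t)).
Proof.
move=> t; apply: continuous_comp; first exact: mulrl_continuous.
exact: continuous_cos.
Qed.

Lemma continuous_sinM (c : R) : continuous (fun t : R => sin (c * t)).
Proof.
move=> t; apply: continuous_comp; first exact: mulrl_continuous.
exact: continuous_sin.
Qed.

Lemma Rintegral_cos k :
  Rintegral mu `[- pi, pi] (fun t => cos (k%:~R * t)) = (2 * pi) *+ (k == 0).
Proof.
have pi0 : - pi < pi :> R by rewrite gtrN// pi_gt0.
have [->|k0] := eqVneq k 0.
  under eq_Rintegral do rewrite mul0r cos0.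
  rewrite (@Rintegral_is_derive _ _ _ id)//; first by rewrite opprK mulr1n; ring.
  by move=> x; exact: cvg_cst.
have kR : k%:~R != 0 :> R by rewrite intr_eq0.
have dF (x : R) : is_derive x 1 (fun t => k%:~R^-1 * sin (k%:~R * t)) (cos (k%:~R * x)).
  apply: is_derive_eq.
  by rewrite /GRing.scale/=; field.
rewrite (Rintegral_is_derive pi0 _ dF); last exact: continuous_cosM.
by rewrite mulrN sinN sin_intpi oppr0 mulr0 subrr.
Qed.

Lemma Rintegral_sin k :
  Rintegral mu `[- pi, pi] (fun t => sin (k%:~R * t)) = 0.
Proof.
have pi0 : - pi < pi :> R by rewrite gtrN// pi_gt0.
have [->|k0] := eqVneq k 0.
  under eq_Rintegral do rewrite mul0r sin0.
  by rewrite Rintegral_cst// mul0r.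
have kR : k%:~R != 0 :> R by rewrite intr_eq0.
have dF (x : R) : is_derive x 1 (fun t => - (k%:~R^-1 * cos (k%:~R * t))) (sin (k%:~R * x)).
  apply: is_derive_eq.
  by rewrite /GRing.scale/=; field.
rewrite (Rintegral_is_derive pi0 _ dF); last exact: continuous_sinM.
by rewrite mulrN cosN subrr.
Qed.

Definition bdiff_symbol (t : R) : R[i] := 1 - expi t.

Lemma bdiff_symbol_integrable : cintegrable `[- pi, pi] bdiff_symbol.
Proof.
split; apply: (@integrable_continuous_itv _ _ (fun t => _)) => t /=.
- apply: cvgB; [exact: cvg_cst | exact: continuous_cos].
- apply: cvgB; [exact: cvg_cst | exact: continuous_sin].
Qed.

(** The addition formulas turn [(1 - e^(i t)) e^(- i k t)] into
    [e^(- i k t) - e^(- i (k - 1) t)], whose integral over a period only sees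
    [k = 0] and [k = 1]. *)
Lemma fourier_bdiff_symbol k :
  fourier_coef bdiff_symbol k = (k == 0)%:R - (k == 1)%:R.
Proof.
have fE t : bdiff_symbol t * expi (- (k%:~R * t)) =
    ((cos (k%:~R * t) - cos ((k - 1)%:~R * t)) +i*
     (sin ((k - 1)%:~R * t) - sin (k%:~R * t)))%C.
  have -> : (k - 1)%:~R * t = k%:~R * t - t by rewrite intrB mulrBl mul1r.
  rewrite cosB sinB /bdiff_symbol /expi cosN sinN.
  by apply/eqP; rewrite eq_complex/=; apply/andP; split; apply/eqP; ring.
rewrite /fourier_coef /cintegral.
under [X in (X +i* _)%C]eq_Rintegral do rewrite fE/=.
under [X in (_ +i* X)%C]eq_Rintegral do rewrite fE/=.
have ic c := integrable_continuous_itv (- pi) pi (@continuous_cosM c).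
have isn c := integrable_continuous_itv (- pi) pi (@continuous_sinM c).
rewrite !RintegralB// !Rintegral_sin !Rintegral_cos subrr subr_eq0.
rewrite -[(_ +i* 0)%C]/(_%:C%C) rmorphB/= !rmorphMn/=.
have p0 : 2 * pi != 0 :> R by rewrite mulf_neq0 ?gt_eqF ?pi_gt0.
move: (2 * pi) p0 => p p0.
by rewrite fmorphV mulrBr !mulrnAr mulVf// fmorph_eq0.
Qed.

End Fourier.

(** * Null sets *)

Section NullSets.
Context {R : realType}.
Notation mu := (@lebesgue_measure R).

Lemma measurable_affine (c s : R) :
  measurable_fun setT (fun y : measurableTypeR R => (c + s * y)%R : measurableTypeR R).
Proof.
apply: continuous_measurable_fun => y; apply: cvgD; first exact: cvg_cst.
exact: mulrl_continuous.
Qed.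

(** The right-hand side is a measure in [A], so by the uniqueness of Lebesgue
    measure it is enough to compare both sides on half-open intervals. *)
Lemma lebesgue_measure_affine (c s : R) (A : set (measurableTypeR R)) : 0 < s ->
  measurable A -> mu A = (s%:E * mu ((fun y : measurableTypeR R => (c + s * y)%R) @^-1` A))%E.
Proof.
move=> s0 mA.
pose phi : measurableTypeR R -> measurableTypeR R := fun y => c + s * y.
have mphi : measurable_fun setT phi.
  exact: measurable_affine.
pose s' := NngNum (ltW s0).
pose nu : {measure set (measurableTypeR R) -> \bar R} :=
  mscale s' (pushforward mu phi).
have muE u v : mu `]u, v] = (s%:E * mu (phi @^-1` `]u, v]))%E.
  have -> : phi @^-1` `]u, v] = `](u - c) / s, (v - c) / s]%classic.
    apply/seteqP; split=> y /=; rewrite !in_itv/= ltr_pdivrMr// ler_pdivlMr//;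
      by rewrite ltrBlDl lerBrDl /phi mulrC.
  rewrite !lebesgue_measure_itv/= !lte_fin ltr_pM2r ?invr_gt0// ltrD2r.
  case: ifPn => _; last by rewrite mule0.
  rewrite -!EFinD -EFinM; congr _%:E; field.
  by rewrite gt_eqF.
rewrite (@lebesgue_measure_unique _ (nu mphi))// => _ [[u v] _ <-].
exact: muE.
Qed.

Lemma negligible_affine (c s : R) (A : set (measurableTypeR R)) : 0 < s ->
  mu.-negligible A ->
  mu.-negligible ((fun y : measurableTypeR R => (c + s * y)%R) @^-1` A).
Proof.
move=> s0 [B [mB B0 AB]].
exists ((fun y : measurableTypeR R => (c + s * y)%R) @^-1` B); split.
- rewrite -[X in measurable X]setTI; apply: measurable_affine => //.
- have := lebesgue_measure_affine c s0 mB; rewrite B0 => /esym/eqP.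
  by rewrite mule_eq0 eqe gt_eqF//= => /eqP.
- by move=> y /AB.
Qed.

Lemma ae_glt_dom_fst (P : R -> Prop) :
  {ae mu, forall y, y \in `[0, 1] -> P y} ->
  {ae mu2, forall p : R * R, glt_dom p -> P p.1}.
Proof.
move=> [B [mB B0 PB]].
exists (B `*` setT); split.
- exact: measurableX.
- apply: etrans (product_measure1E _ _ mB measurableT) _.
  by rewrite [X in (X * _)%E]B0 mul0e.
- move=> [y t] /= yt; split => //; apply: PB => /= Py; apply: yt => -[y01 _].
  exact: Py.
Qed.

End NullSets.

(** * The symbol of the backward difference matrices *)

Section BackwardDifferences.
Context {R : realType}.
Implicit Types g : R -> R.
Notation mu := (@lebesgue_measure R).

Lemma eq_glt (A A' : @mxseq R) (k k' : R * R -> R[i]) :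
  (forall N, A N = A' N) -> (forall p, k p = k' p) -> glt A k -> glt A' k'.
Proof.
move=> AA' kk' Ak; have <- : A = A' by exact: functional_extensionality_dep.
by have <- : k = k' by exact: funext.
Qed.

(** Slope of the chord of [g] over the cell [[i/N, (i+1)/N]]; with indices
    starting at [0], the matching node of [diag_sampling] is [(i+1)/N]. *)
Definition mean_slope g N (i : 'I_N) : R :=
  N%:R * (g (i.+1%:R / N%:R) - g (i%:R / N%:R)).

(** The mean slope is [g' c] for some [c] in a cell of length [1/N] which also
    contains the sampling node; uniform continuity of [g'] concludes. *)
Lemma mean_slope_close g e : C1_on `[0, 1] g -> 0 < e ->
  \forall N \near \oo, forall i : 'I_N,
    `|mean_slope g i - derive_in `[0, 1] g (i.+1%:R / N%:R)| <= e.
Proof.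
move=> gC1 e0.
have [d d0 dP] := compact_unif_continuous (@segment_compact R 0 1) gC1.2 e0.
near=> N => i.
have N0 : 0 < N%:R :> R by rewrite ltr0n (leq_ltn_trans _ (ltn_ord i)).
have Nd : N%:R^-1 < d.
  rewrite -[d]invrK ltf_pV2 ?posrE ?invr_gt0//.
  by near: N; exact: nbhs_infty_gtr.
have ge0 : 0 <= i%:R / N%:R :> R by rewrite divr_ge0.
have le1 : i.+1%:R / N%:R <= 1 :> R by rewrite ler_pdivrMr// mul1r ler_nat.
have step : i.+1%:R / N%:R = i%:R / N%:R + N%:R^-1 :> R.
  by rewrite -natr1 mulrDl mul1r.
have N'0 : 0 < N%:R^-1 :> R by rewrite invr_gt0.
have lt : i%:R / N%:R < i.+1%:R / N%:R :> R by rewrite step ltrDl.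
have [c /andP[ic ci] E] := C1_on_MVT gC1 ge0 lt le1.
have -> : mean_slope g i = derive_in `[0, 1] g c.
  rewrite /mean_slope E step addrAC subrr add0r mulrCA divff ?mulr1//.
  by rewrite gt_eqF.
apply/ltW/dP; rewrite /= ?in_itv/=; [lra|lra|].
by rewrite ltr_norml; lra.
Unshelve. all: by end_near. Qed.

Lemma glt_mean_slope g : C1_on `[0, 1] g ->
  glt (fun N => rdiag (@mean_slope g N))
      (fun p => (derive_in `[0, 1] g p.1)%:C%C).
Proof.
move=> gC1.
have Da : glt (diag_sampling (fun y => (derive_in `[0, 1] g y)%:C%C))
              (fun p => (derive_in `[0, 1] g p.1)%:C%C).
  apply: (@glt_diag R (fun y => (derive_in `[0, 1] g y)%:C%C)); split => /=.
    exact: C1_on_riemann_integrable.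
  exact: riemann_integrable_cst.
have Z0 := glt_zero (rdiag_zero_distributed
  (d := fun N (i : 'I_N) => mean_slope g i - derive_in `[0, 1] g (i.+1%:R / N%:R))
  (fun e => mean_slope_close gC1)).
apply: eq_glt (glt_lin 1 1 Da Z0) => [N|p].
  rewrite !scale1r /diag_sampling /rdiag -raddfD/=; congr diag_mx.
  by apply/rowP => i; rewrite !mxE rmorphB/= addrC subrK.
by rewrite !mul1r addr0.
Qed.

(** After the deletion of the boundary column, column [j] carries the unknown
    [u_(j+1)], so the diagonal of the difference stencil becomes the diagonal
    of the Toeplitz factor.  The identity is exact also where a mean slope
    vanishes, both sides being then [0] in that row. *)
Lemma bdiff_mx_factor g N :
  rdiag (fun i => (@mean_slope g N i)^-1) *m toeplitz (@bdiff_symbol R) N =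
  map_mx (real_complex R)
    (col' ord0 (N%:R^-1 *: bdiff_mx (fun i => g (i%:R / N%:R)) N)).
Proof.
apply/matrixP => i j; rewrite /rdiag mul_diag_mx !mxE fourier_bdiff_symbol subr_eq0.
rewrite eqSS [in LHS]eqz_nat.
have -> : (i%:Z - j%:Z == 1) = (lift ord0 j == i :> nat).
  by rewrite subr_eq -intS eqz_nat eq_sym.
rewrite invfM !rmorphM/= rmorphB/= !rmorph_nat eq_sym.
by rewrite -mulrA [X in _ * X]mulrC.
Qed.

Lemma glt_bdiff g : C1_on `[0, 1] g ->
  {ae mu, forall y, y \in `[0, 1] -> derive_in `[0, 1] g y != 0} ->
  glt (fun N => map_mx (real_complex R)
         (col' ord0 (N%:R^-1 *: bdiff_mx (fun i => g (i%:R / N%:R)) N)))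
      (fun p => (1 - expi p.2) / (derive_in `[0, 1] g p.1)%:C%C).
Proof.
move=> gC1 g'n0.
have nz : {ae @mu2 R, forall p, glt_dom p -> (derive_in `[0, 1] g p.1)%:C%C != 0}.
  apply: negligibleS (ae_glt_dom_fst g'n0) => p /=; apply: contra_not => np pd.
  by rewrite fmorph_eq0 np.
have inv := glt_pinv (glt_mean_slope gC1) nz
  (fun N => rdiag_moore_penrose (@mean_slope g N)).
apply: eq_glt (glt_mul inv (glt_toeplitz (@bdiff_symbol_integrable R))) => [N|p].
  exact: bdiff_mx_factor.
by rewrite mulrC.
Qed.

End BackwardDifferences.

Theorem lemma4p7 (R : realType) (ghat g : R -> R)
  (ghatC1 : C1_on `[-1, 1] ghat)
  (ghatN1 : ghat (-1) = -1)
  (ghat1 : ghat 1 = 1)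
  (ghat_pos : {ae (@lebesgue_measure R),
     forall x, x \in `[-1, 1] -> 0 < derive_in `[-1, 1] ghat x})
  (gE : forall y, y \in `[0, 1] -> g y = ghat (-1 + 2 * y)) :
  glt (fun N => map_mx (real_complex R)
         (col' ord0 (N%:R^-1 *: bdiff_mx (fun i => g (i%:R / N%:R)) N)))
      (fun p => (1 - expi p.2) / (derive_in `[0, 1] g p.1)%:C%C).
Proof.
have ends : -1 + 2 * 0 = -1 :> R /\ -1 + 2 * 1 = 1 :> R by split; ring.
have two0 : 0 < 2 :> R by [].
have [] := @C1_on_affine R 0 1 (-1) 2 g ghat ltr01 two0.
- by move=> y y01; apply: gE; rewrite in_itv.
- by rewrite ends.1 ends.2.
rewrite ends.1 ends.2 => gC1 dg.
apply: glt_bdiff gC1 _.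
have := negligible_affine (-1) two0 ghat_pos.
apply: negligibleS => y /= ny; apply: contra_not ny => pos y01.
have y01' : 0 <= y <= 1 by move: y01; rewrite in_itv.
rewrite dg// mulf_neq0// gt_eqF// pos// in_itv/=.
lra.
Qed.
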